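(* There exist absolute constants $c\in(0,1)$, $C>0$, $c'>0$ and $m_0$ such that for every integer $m\ge m_0$, with $X=[m]=\{1,\dots,m\}$ and considering distributions $\mathrm{Unif}(X')$ for nonempty $X'\subseteq X$: (1) Let $n_{\mathrm{small}}=\lceil C\sqrt m\rceil$. For every integer $1\le k\le m$ there is $f:X^{n_{\mathrm{small}}}\to\{0,1\}$ such that: if $|X'|\ge k$, then for every $\mathcal D'\in\mathrm{sub}(\mathrm{Unif}(X'))$, $\Pr_{S\sim(\mathcal D')^{n_{\mathrm{small}}}}[f(S)=1]\ge0.99$; and if $|X'|\le ck$, then for every $\mathcal D'\in\mathrm{sub}(\mathrm{Unif}(X'))$, $\Pr_{S\sim(\mathcal D')^{n_{\mathrm{small}}}}[f(S)=1]\le0.01$. (2) Let $N=\lfloor c'm\rfloor$ and $k=m$. For every $f:X^N\to\{0,1\}$, either there is $X'$ with $|X'|=m$ such that $\mathbb E_{S\sim\mathrm{Unif}(X')^{2N}}\big[\min_{S'\in\mathrm{sub}(S)}f(S')\big]\le0.51$, or there is $X'$ with $|X'|\le cm$ such that $\mathbb E_{S\sim\mathrm{Unif}(X')^{2N}}\big[\max_{S'\in\mathrm{sub}(S)}f(S')\big]\ge0.49$. (Thus no $f$ using $N=\Theta(m)$ samples achieves under adaptive subtractive contamination the distinguishing guarantee that $O(\sqrt m)$ samples achieve under oblivious subtractive contamination.)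
   Context: For a distribution $\mathcal D$, $\mathrm{sub}(\mathcal D)$ is the set of distributions obtained as the law of $x\sim\mathcal D$ conditioned on some event of probability (at least) $1/2$ (oblivious $1/2$-subtractive contamination). For a sample $S\in X^{2N}$, $\mathrm{sub}(S)$ is the set of samples $S'\in X^N$ with $S'_j=S_{i_j}$ for some $N$ distinct indices $i_1,\dots,i_N\in[2N]$ (adaptive $1/2$-subtractive contamination: the adversary sees $S$ and removes half of it). *)

(* Defs.v *)
From HB Require Import structures.
From mathcomp Require Import all_boot all_order all_algebra.
From mathcomp Require Import reals.
Set Implicit Arguments. Unset Strict Implicit. Unset Printing Implicit Defensive.
Import Order.TTheory GRing.Theory Num.Theory.
Local Open Scope ring_scope.

Section Defs.
Variables (R : numFieldType) (T : finType).

Definition is_distr (D : T -> R) : Prop :=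
  (forall x, 0 <= D x) /\ \sum_(x : T) D x = 1.

Definition unif (A : {set T}) : T -> R :=
  fun x => if x \in A then (#|A|%:R)^-1 else 0.

(* D' in sub(D): D' is the law of x ~ D conditioned on an event of probability
   at least 1/2 (oblivious 1/2-subtractive contamination); equivalently
   D' is a distribution with D' <= 2 D pointwise. *)
Definition in_osub (D D' : T -> R) : Prop :=
  is_distr D' /\ forall x, D' x <= 2 * D x.

Definition prob_iid (n : nat) (D : T -> R) (f : {ffun 'I_n -> T} -> bool) : R :=
  \sum_(S : {ffun 'I_n -> T} | f S) \prod_(i < n) D (S i).

Definition expect_iid (n : nat) (D : T -> R) (g : {ffun 'I_n -> T} -> R) : R :=
  \sum_(S : {ffun 'I_n -> T}) (\prod_(i < n) D (S i)) * g S.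

Definition asub (N : nat) (S : {ffun 'I_(2 * N) -> T}) : {set {ffun 'I_N -> T}} :=
  [set S' : {ffun 'I_N -> T} | [exists i : {ffun 'I_N -> 'I_(2 * N)},
              injectiveb i && [forall j, S' j == S (i j)]]].

Definition min_asub (N : nat) (f : {ffun 'I_N -> T} -> bool)
    (S : {ffun 'I_(2 * N) -> T}) : R :=
  \big[Num.min/1]_(S' in asub S) ((f S' : nat)%:R).
Definition max_asub (N : nat) (f : {ffun 'I_N -> T} -> bool)
    (S : {ffun 'I_(2 * N) -> T}) : R :=
  \big[Num.max/0]_(S' in asub S) ((f S' : nat)%:R).

End Defs.

(* Main.v *)
Require Import Defs.
From HB Require Import structures.
From mathcomp Require Import all_boot all_order all_algebra all_fingroup all_solvable.
From mathcomp Require Import ring lra zify.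
From mathcomp Require Import reals.
Import Order.TTheory GRing.Theory Num.Theory.
Local Open Scope ring_scope.
Set Implicit Arguments. Unset Strict Implicit. Unset Printing Implicit Defensive.

(* Oblivious part: the tester thresholds the number of colliding pairs of the
   sample at 100 n^2 / k.  Every D <= 2 Unif(X') has collision probability
   sum D^2 between 1/|X'| and 2/|X'|, so Markov's inequality bounds the number
   of collisions when |X'| >= k, and Chebyshev's inequality bounds it from below
   when |X'| <= k/800, since sum D^3 <= 2 (sum D^2)^2.
   Adaptive part: 2N samples from a set of size at least 200 N have, with
   probability 99/100, at most N collisions, so the adversary can keep N
   distinct points.  Averaging f over all relabelings of [m] gives the same value
   p on every tuple of distinct points; hence the minimum over sub(S) is at most
   p + 0.01 on average for X' = [m], while the maximum is at least p - 0.01 on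
   average for some relabeling of a fixed set of size floor(m/800).  According to
   whether p <= 1/2, one of the two alternatives holds. *)

(** * Expectations over i.i.d. samples *)

Section Expectation.
Variables (R : realFieldType) (T : finType) (D : T -> R).

Lemma expect_iidD n (g h : {ffun 'I_n -> T} -> R) :
  expect_iid D (fun S => g S + h S) = expect_iid D g + expect_iid D h.
Proof. by rewrite -big_split /=; apply: eq_bigr => S _; rewrite mulrDr. Qed.

Lemma expect_iidZ n a (g : {ffun 'I_n -> T} -> R) :
  expect_iid D (fun S => a * g S) = a * expect_iid D g.
Proof. by rewrite /expect_iid mulr_sumr; apply: eq_bigr => S _; rewrite mulrCA. Qed.

Lemma eq_expect_iid n (g h : {ffun 'I_n -> T} -> R) :
  g =1 h -> expect_iid D g = expect_iid D h.
Proof. by move=> e; apply: eq_bigr => S _; rewrite e. Qed.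

Lemma expect_iid_sum n (I : finType) (g : I -> {ffun 'I_n -> T} -> R) :
  \sum_i expect_iid D (g i) = expect_iid D (fun S => \sum_i g i S).
Proof.
by rewrite /expect_iid exchange_big; apply: eq_bigr => S _; rewrite mulr_sumr.
Qed.

Lemma prob_iidE n (f : {ffun 'I_n -> T} -> bool) :
  prob_iid D f = expect_iid D (fun S => (f S)%:R).
Proof.
rewrite /prob_iid big_mkcond; apply: eq_bigr => S _.
by case: (f S); rewrite ?mulr1 ?mulr0.
Qed.

Hypothesis D_distr : is_distr D.

Lemma expect_iid_cst n a : expect_iid D (fun _ : {ffun 'I_n -> T} => a) = a.
Proof.
rewrite /expect_iid -mulr_suml -(bigA_distr_bigA (fun _ => D)).
by rewrite big1 ?mul1r // => i _; case: D_distr.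
Qed.

Lemma le_expect_iid n (g h : {ffun 'I_n -> T} -> R) :
  (forall S, g S <= h S) -> expect_iid D g <= expect_iid D h.
Proof.
move=> gh; apply: ler_sum => S _; apply: ler_wpM2l => //.
by apply: prodr_ge0 => i _; case: D_distr.
Qed.

Definition fcons n x (S : {ffun 'I_n -> T}) : {ffun 'I_n.+1 -> T} :=
  [ffun i => oapp S x (unlift ord0 i)].

Lemma fcons0 n x (S : {ffun 'I_n -> T}) : fcons x S ord0 = x.
Proof. by rewrite ffunE unlift_none. Qed.

Lemma fconsS n x (S : {ffun 'I_n -> T}) i : fcons x S (lift ord0 i) = S i.
Proof. by rewrite ffunE liftK. Qed.

Lemma codom_fcons n x (S : {ffun 'I_n -> T}) :
  codom (fcons x S) = x :: codom S.
Proof.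
rewrite /codom /image_mem enum_ordSl /= fcons0 -map_comp; congr cons.
by apply: eq_map => i /=; rewrite fconsS.
Qed.

Lemma expect_iidS n (g : {ffun 'I_n.+1 -> T} -> R) :
  expect_iid D g =
  expect_iid D (fun S => \sum_x D x * g (fcons x S)).
Proof.
pose h (p : {ffun 'I_n -> T} * T) := fcons p.2 p.1.
have hb : bijective h.
  exists (fun S : {ffun 'I_n.+1 -> T} => ([ffun i => S (lift ord0 i)], S ord0)).
    move=> [S x] /=; rewrite /h /= fcons0; congr pair.
    by apply/ffunP => i; rewrite ffunE fconsS.
  move=> S; apply/ffunP => i; rewrite /h /=.
  by case: (unliftP ord0 i) => [j|] ->; rewrite ?fcons0 ?fconsS ?ffunE.
rewrite /expect_iid (reindex h) /=; last exact: onW_bij.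
rewrite -(pair_bigA _ (fun S x =>
  (\prod_(i < n.+1) D (fcons x S i)) * g (fcons x S))) /=.
apply: eq_bigr => S _; rewrite mulr_sumr; apply: eq_bigr => x _.
rewrite big_ord_recl fcons0 [in RHS]mulrCA mulrA; congr (_ * _ * _).
by apply: eq_bigr => i _; rewrite fconsS.
Qed.

(** Viewing the sample as a list lets one function [g] serve every sample size, so that
    [expect_seqS] supports induction on [n] for statistics defined by recursion on lists. *)
Definition expect_seq n (g : seq T -> R) : R :=
  expect_iid D (fun S : {ffun 'I_n -> T} => g (codom S)).

Lemma expect_seq0 g : expect_seq 0 g = g [::].
Proof.
rewrite /expect_seq (eq_expect_iid _ (h := fun _ => g [::])) ?expect_iid_cst //.
by move=> S; congr g; apply: size0nil; rewrite size_codom card_ord.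
Qed.

Lemma expect_seqS n g :
  expect_seq n.+1 g = expect_seq n (fun s => \sum_x D x * g (x :: s)).
Proof.
rewrite /expect_seq expect_iidS; apply: eq_expect_iid => S.
by apply: eq_bigr => x _; rewrite codom_fcons.
Qed.

Lemma eq_expect_seq n g h : g =1 h -> expect_seq n g = expect_seq n h.
Proof. by move=> e; apply: eq_expect_iid => S. Qed.

Lemma expect_seqD n g h :
  expect_seq n (fun s => g s + h s) = expect_seq n g + expect_seq n h.
Proof. exact: expect_iidD. Qed.

Lemma expect_seqZ n a g : expect_seq n (fun s => a * g s) = a * expect_seq n g.
Proof. exact: expect_iidZ. Qed.

Lemma expect_seq_cst n a : expect_seq n (fun _ => a) = a.
Proof. exact: expect_iid_cst. Qed.

End Expectation.

(** * Collisions *)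

(* Number of pairs i < j with equal entries. *)
Fixpoint collisions (T : eqType) (s : seq T) : nat :=
  if s is x :: s' then (collisions s' + count_mem x s')%N else 0%N.

(** Every entry discarded by [undup] equals a later entry, hence accounts for at least one
    collision. *)
Lemma size_undup_collisions (T : eqType) (s : seq T) :
  (size s <= size (undup s) + collisions s)%N.
Proof.
elim: s => //= x s IH; case: ifP => xs /=.
  rewrite addnA -addn1 leq_add //.
  by rewrite -has_count has_pred1.
by rewrite addSn ltnS (leq_trans IH) // leq_add2l leq_addr.
Qed.

Section CollisionMoments.
Variables (R : realFieldType) (T : finType) (D : T -> R).
Hypothesis D_distr : is_distr D.

Definition moment k : R := \sum_x D x ^+ k.

Definition mass k (s : seq T) : R := \sum_(y <- s) D y ^+ k.

Lemma sum_count_mem (h : T -> R) (s : seq T) :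
  \sum_x h x * (count_mem x s)%:R = \sum_(y <- s) h y.
Proof.
elim: s => [|y s IH]; first by rewrite big_nil big1 // => x _; rewrite mulr0.
rewrite big_cons -IH (bigD1 y) //= [in RHS](bigD1 y) //= eqxx natrD mulrDr mulr1.
rewrite -addrA; congr (_ + (_ + _)).
by apply: eq_bigr => x /negPf xy; rewrite eq_sym xy.
Qed.

Lemma sum_distr_mulr a : \sum_x D x * a = a.
Proof. by rewrite -mulr_suml; case: D_distr => _ ->; rewrite mul1r. Qed.

(* The moments of the number of collisions follow by recursion on the sample
   size: prepending x ~ D to s adds count_mem x s collisions, and averaging
   over x produces the power sums [mass] and [sq_count] of s. *)
Local Notation E := (expect_seq D).

Lemma expect_mass k n : E n (mass k) = n%:R * moment k.+1.
Proof.
elim: n => [|n IH]; first by rewrite (expect_seq0 D_distr) /mass big_nil mul0r.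
rewrite expect_seqS (eq_expect_seq _ _ (h := fun s => mass k s + moment k.+1)).
  by rewrite expect_seqD (expect_seq_cst D_distr) IH -natr1; ring.
move=> s; rewrite -[mass k s in RHS]sum_distr_mulr -big_split /=; apply: eq_bigr => x _.
by rewrite /mass big_cons exprS /=; ring.
Qed.

Lemma expect_mass_sq n :
  E n (fun s => mass 1 s ^+ 2) =
  n%:R * moment 3 + n%:R * (n%:R - 1) * moment 2 ^+ 2.
Proof.
elim: n => [|n IH].
  by rewrite (expect_seq0 D_distr) /mass big_nil; ring.
rewrite expect_seqS (eq_expect_seq _ _ (h := fun s =>
  mass 1 s ^+ 2 + ((2 * moment 2) * mass 1 s + moment 3))).
  rewrite !(expect_seqD, expect_seqZ) (expect_seq_cst D_distr) IH expect_mass.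
  by rewrite -natr1; ring.
move=> s; rewrite -[mass 1 s ^+ 2 in RHS]sum_distr_mulr.
rewrite [2 * _]mulr_sumr [X in _ + (X + _)]mulr_suml -!big_split /=; apply: eq_bigr => x _.
by rewrite {1}/mass big_cons -/(mass 1 s); ring.
Qed.

(** Given [s], this is the second moment of the number of collisions created by one fresh draw from
    [D]. *)
Definition sq_count (s : seq T) : R := \sum_x D x * (count_mem x s)%:R ^+ 2.

Lemma expect_sq_count n :
  E n sq_count = n%:R * moment 2 + n%:R * (n%:R - 1) * moment 3.
Proof.
elim: n => [|n IH].
  rewrite (expect_seq0 D_distr) /sq_count big1; first by ring.
  by move=> x _; rewrite /= expr0n mulr0.
rewrite expect_seqS (eq_expect_seq _ _ (h := fun s =>
  sq_count s + (2 * mass 2 s + moment 2))).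
  rewrite !(expect_seqD, expect_seqZ) (expect_seq_cst D_distr) IH expect_mass.
  by rewrite -natr1; ring.
move=> s; rewrite -[sq_count s in RHS]sum_distr_mulr -[mass 2 s](sum_count_mem (fun y => D y ^+ 2)).
rewrite mulr_sumr -!big_split /=; apply: eq_bigr => x _ /=.
(* Only the count of [x] changes, from c to c + 1, and its square grows by 1 + 2c. *)
have -> : sq_count (x :: s) = sq_count s + D x * (1 + 2 * (count_mem x s)%:R).
  rewrite /sq_count (bigD1 x) //= [in RHS](bigD1 x) //= eqxx natrD.
  under eq_bigr => y /negPf yx do rewrite eq_sym yx add0n.
  by rewrite /=; ring.
by ring.
Qed.

Local Notation coll s := ((collisions s)%:R : R).

Lemma expect_collisions n :
  E n (fun s => coll s) = n%:R * (n%:R - 1) / 2 * moment 2.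
Proof.
elim: n => [|n IH]; first by rewrite (expect_seq0 D_distr) /= !mul0r.
rewrite expect_seqS (eq_expect_seq _ _ (h := fun s => coll s + mass 1 s)).
  by rewrite expect_seqD IH expect_mass -natr1; field.
move=> s; rewrite -[coll s in RHS]sum_distr_mulr -[mass 1 s](sum_count_mem (fun y => D y ^+ 1)) -big_split /=.
by apply: eq_bigr => x _; rewrite /= natrD expr1 mulrDr.
Qed.

(** The two terms correspond to a pair {i, j} together with an index l, according to whether l lies
    in the pair or not. *)
Lemma expect_collisions_mass n :
  E n (fun s => coll s * mass 1 s) =
  n%:R * (n%:R - 1) * moment 3
  + n%:R * (n%:R - 1) * (n%:R - 2) / 2 * moment 2 ^+ 2.
Proof.
elim: n => [|n IH]; first by rewrite (expect_seq0 D_distr) /= !mul0r add0r.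
rewrite expect_seqS (eq_expect_seq _ _ (h := fun s => coll s * mass 1 s +
  (moment 2 * coll s + (mass 1 s ^+ 2 + mass 2 s)))).
  rewrite !(expect_seqD, expect_seqZ) IH expect_collisions expect_mass_sq.
  by rewrite expect_mass -natr1; field.
move=> s; have mE : mass 1 s = \sum_x D x * (count_mem x s)%:R.
  by rewrite sum_count_mem; apply: eq_bigr.
pose h x := (D x * (coll s * mass 1 s) + D x ^+ 2 * coll s)
  + (D x * (count_mem x s)%:R * mass 1 s + D x ^+ 2 * (count_mem x s)%:R).
rewrite (eq_bigr h) => [|x _]; last first.
  by rewrite /h {1}/mass big_cons -/(mass 1 s) /= natrD; ring.
rewrite !big_split /= sum_distr_mulr -!mulr_suml -mE [mass 1 s ^+ 2]expr2 -addrA.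
by congr (_ + (_ + (_ + _))); apply: sum_count_mem (fun y => D y ^+ 2) s.
Qed.

(** The three terms count ordered couples of index pairs: equal pairs, pairs sharing exactly one
    index, and disjoint pairs. *)
Lemma expect_collisions_sq n :
  E n (fun s => coll s ^+ 2) =
  n%:R * (n%:R - 1) / 2 * moment 2
  + n%:R * (n%:R - 1) * (n%:R - 2) * moment 3
  + n%:R * (n%:R - 1) * (n%:R - 2) * (n%:R - 3) / 4 * moment 2 ^+ 2.
Proof.
elim: n => [|n IH].
  by rewrite (expect_seq0 D_distr) /= expr0n !mul0r !add0r.
rewrite expect_seqS (eq_expect_seq _ _ (h := fun s => coll s ^+ 2 +
  (2 * (coll s * mass 1 s) + sq_count s))).
  rewrite !(expect_seqD, expect_seqZ) IH expect_collisions_mass expect_sq_count.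
  by rewrite -natr1; field.
move=> s; have mE : mass 1 s = \sum_x D x * (count_mem x s)%:R.
  by rewrite sum_count_mem; apply: eq_bigr.
rewrite -[coll s ^+ 2 in RHS]sum_distr_mulr mE !mulr_sumr -!big_split.
by apply: eq_bigr => x _ /=; rewrite natrD; ring.
Qed.

End CollisionMoments.

(** * Tail bounds for the number of collisions *)

Section CollisionTest.
Variables (R : realFieldType) (T : finType) (D : T -> R).
Hypothesis D_distr : is_distr D.

Lemma markov_iid n (f : {ffun 'I_n -> T} -> bool) (g : {ffun 'I_n -> T} -> R) b :
  0 < b -> (forall S, 0 <= g S) -> (forall S, f S -> b <= g S) ->
  prob_iid D f <= expect_iid D g / b.
Proof.
move=> b0 g0 fg; rewrite prob_iidE ler_pdivlMr // mulrC -expect_iidZ.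
apply: le_expect_iid => // S.
by case: (boolP (f S)) => [/fg|_]; rewrite ?mulr1 ?mulr0.
Qed.

Lemma prob_iidC n (f : {ffun 'I_n -> T} -> bool) :
  prob_iid D f = 1 - prob_iid D (fun S => ~~ f S).
Proof.
rewrite !prob_iidE; apply/eqP; rewrite eq_sym subr_eq -expect_iidD.
rewrite -[X in X == _](expect_iid_cst D_distr n 1); apply/eqP/eq_expect_iid => S.
by case: (f S); rewrite ?addr0 ?add0r.
Qed.

Lemma moment_ge0 k : 0 <= moment D k.
Proof. by apply: sumr_ge0 => x _; apply: exprn_ge0; case: D_distr. Qed.

Lemma moment1 : moment D 1 = 1.
Proof. by case: D_distr => _ <-; apply: eq_bigr. Qed.

Lemma momentS_le k b : (forall x, D x <= b) -> moment D k.+1 <= b * moment D k.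
Proof.
move=> Db; rewrite /moment mulr_sumr; apply: ler_sum => x _.
by rewrite exprS ler_wpM2r // exprn_ge0; case: D_distr.
Qed.

(** Cauchy-Schwarz, obtained by expanding the sum over [A] of the squares of D x - 1/|A|. *)
Lemma moment2_ge (A : {set T}) : (0 < #|A|)%N ->
  (forall x, x \notin A -> D x = 0) -> #|A|%:R^-1 <= moment D 2.
Proof.
move=> A0 DA; set a : R := #|A|%:R; have a0 : 0 < a by rewrite ltr0n.
have sumA h : (forall x, x \notin A -> h x = 0) -> \sum_x h x = \sum_(x in A) h x :> R.
  by move=> hA; rewrite (bigID (mem A)) /= [X in _ + X]big1 ?addr0.
have DA2 : \sum_(x in A) D x ^+ 2 = moment D 2.
  by rewrite -sumA // => x /DA ->; rewrite expr0n.
have DA1 : \sum_(x in A) D x = 1 by rewrite -sumA //; case: D_distr.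
have : 0 <= \sum_(x in A) (D x - a^-1) ^+ 2.
  by apply: sumr_ge0 => x _; apply: sqr_ge0.
rewrite (eq_bigr (fun x => D x ^+ 2 + (- (2 / a) * D x + a^-1 ^+ 2))); last first.
  by move=> x _; ring.
rewrite !big_split /= -mulr_sumr DA1 DA2 sumr_const -[_ *+ #|_|]mulr_natl -/a.
have -> : a * a^-1 ^+ 2 = a^-1 by field; rewrite gt_eqF.
by lra.
Qed.

Lemma variance_collisions n (mu := n%:R * (n%:R - 1) / 2 * moment D 2) :
  expect_seq D n (fun s => ((collisions s)%:R - mu) ^+ 2) <=
  mu + n%:R * (n%:R - 1) * (n%:R - 2) * moment D 3.
Proof.
rewrite (eq_expect_seq _ _ (h := fun s => (collisions s)%:R ^+ 2 +
  ((- (2 * mu)) * (collisions s)%:R + mu ^+ 2))); last by move=> s; ring.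
rewrite !(expect_seqD, expect_seqZ) (expect_seq_cst D_distr).
rewrite expect_collisions // expect_collisions_sq // -/mu.
(* This is four times the gap between mu^2 and the disjoint-pair term. The factor 4n - 6 is negative
   for n < 2, where n(n - 1) vanishes. *)
have : 0 <= n%:R * (n%:R - 1) * (4 * n%:R - 6) * moment D 2 ^+ 2.
  rewrite mulr_ge0 ?sqr_ge0 //; case: n {mu} => [|[|n]].
  - by rewrite !mul0r.
  - by rewrite subrr mulr0 mul0r.
  - by rewrite -!natr1; have := ler0n R n; nra.
by rewrite /mu; nra.
Qed.

(** Chebyshev at distance mu/2: the variance is at most mu + (8/n) mu^2, which gives 4/mu + 32/n,
    and each summand is at most 1/200. *)
Lemma prob_few_collisions n t (mu := n%:R * (n%:R - 1) / 2 * moment D 2) :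
  moment D 3 <= 2 * moment D 2 ^+ 2 -> 6400 <= n%:R :> R -> 800 <= mu ->
  t <= mu / 2 ->
  prob_iid D (fun S : {ffun 'I_n -> T} => (collisions (codom S))%:R <= t)
    <= 1 / 100.
Proof.
move=> m3 n_ge mu_ge t_le.
have mu2 : 0 < (mu / 2) ^+ 2 by rewrite exprn_gt0 //; lra.
pose g (S : {ffun 'I_n -> T}) := ((collisions (codom S))%:R - mu) ^+ 2.
have : prob_iid D (fun S : {ffun 'I_n -> T} => (collisions (codom S))%:R <= t)
    <= expect_iid D g / (mu / 2) ^+ 2.
  apply: markov_iid => // [S|S St]; first exact: sqr_ge0.
  by rewrite /g; nra.
move/le_trans; apply; rewrite ler_pdivrMr //.
apply: le_trans (variance_collisions n) _; rewrite -/mu.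
have : n%:R * (n%:R - 1) * (n%:R - 2) * moment D 3
    <= n%:R * (n%:R - 1) ^+ 2 * (2 * moment D 2 ^+ 2).
  apply: ler_pM => //; first by rewrite !mulr_ge0 //; lra.
  - exact: moment_ge0.
  - by nra.
have -> : n%:R * (n%:R - 1) ^+ 2 * (2 * moment D 2 ^+ 2) = 8 / n%:R * mu ^+ 2.
  by rewrite /mu; field; lra.
have : 8 / n%:R * mu ^+ 2 <= 8 / 6400 * mu ^+ 2.
  by rewrite ler_wpM2r ?sqr_ge0 // ler_wpM2l // lef_pV2 ?posrE //; lra.
by nra.
Qed.

Lemma prob_many_collisions n b t : (forall x, D x <= b) -> 0 < t ->
  prob_iid D (fun S : {ffun 'I_n -> T} => t <= (collisions (codom S))%:R)
    <= n%:R ^+ 2 / 2 * b / t.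
Proof.
move=> Db t0.
have : prob_iid D (fun S : {ffun 'I_n -> T} => t <= (collisions (codom S))%:R)
    <= expect_seq D n (fun s => (collisions s)%:R) / t.
  by apply: markov_iid => // S; apply: ler0n.
move/le_trans; apply; rewrite ler_pM2r ?invr_gt0 // expect_collisions //.
have := momentS_le 1 Db; rewrite moment1 mulr1 => m2b.
have := moment_ge0 2; have := ler0n R n; nra.
Qed.

End CollisionTest.

(** * Relabeling *)

Section Permutation.
Variables (R : realFieldType) (T : finType).

Definition relabel (I : finType) (s : {perm T}) (t : {ffun I -> T}) : {ffun I -> T} :=
  [ffun i => s (t i)].

(** The symmetric group is |T|-transitive, hence |I|-transitive; injective families are encoded as
    duplicate-free tuples. *)
Lemma injective_perm_trans (I : finType) (t u : {ffun I -> T}) :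
  injective t -> injective u -> exists s, u = relabel s t.
Proof.
move=> t_inj u_inj.
have dt (v : {ffun I -> T}) : injective v -> codom_tuple v \in #|I|.-dtuple([set: T]).
  move=> v_inj; rewrite inE; apply/andP; split; last by apply/subsetP.
  exact/injectiveP.
have cI : (#|I| <= #|T|)%N by rewrite -(card_codom t_inj) max_card.
have := atransP2 (ntransitive_weak cI (Sym_trans T)) (dt t t_inj) (dt u u_inj).
case=> s _ e; exists s; apply/ffunP => i; rewrite ffunE.
have := congr1 (fun v => tnth v (enum_rank i)) e.
by rewrite !tnth_map /= (tnth_nth i) /= nth_enum_rank.
Qed.

(** Both tuples lie in one orbit, and translating the summation index in the group carries one sum
    to the other. *)
Lemma sum_relabel (I : finType) (t u : {ffun I -> T}) (F : {ffun I -> T} -> R) :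
  injective t -> injective u ->
  \sum_(s : {perm T}) F (relabel s t) = \sum_(s : {perm T}) F (relabel s u).
Proof.
move=> t_inj u_inj; have [a ->] := injective_perm_trans t_inj u_inj.
rewrite (reindex_inj (mulgI a)); apply: eq_bigr => s _; congr F.
by apply/ffunP => i; rewrite !ffunE permM.
Qed.

Lemma relabel_bij (I : finType) s : bijective (@relabel I s).
Proof.
by exists (relabel s^-1) => t; apply/ffunP => i; rewrite !ffunE ?permK ?permKV.
Qed.

Lemma expect_unif_relabel n (A : {set T}) (s : {perm T}) (g : {ffun 'I_n -> T} -> R) :
  expect_iid (unif R (s @: A)) g =
  expect_iid (unif R A) (fun S => g (relabel s S)).
Proof.
rewrite /expect_iid (reindex (relabel s)); last exact/onW_bij/relabel_bij.
apply: eq_bigr => S _; congr (_ * _); apply: eq_bigr => i _.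
by rewrite ffunE /unif (mem_imset _ _ (@perm_inj _ s)) (card_imset _ (@perm_inj _ s)).
Qed.

Lemma unif_distr (A : {set T}) : (0 < #|A|)%N -> is_distr (unif R A).
Proof.
move=> A0; split=> [x|]; first by rewrite /unif; case: ifP; rewrite ?invr_ge0 ?ler0n.
by rewrite -big_mkcond sumr_const -[_ *+ #|_|]mulr_natl divff // pnatr_eq0 -lt0n.
Qed.

(** With at most N collisions, 2N draws show at least N distinct values. The adversary's indices are
    fixed before [s], so one [t] serves all relabelings. *)
Lemma asub_distinct N (S : {ffun 'I_(2 * N) -> T}) :
  (collisions (codom S) <= N)%N ->
  exists2 t : {ffun 'I_N -> T}, injective t &
    forall s, relabel s t \in asub (relabel s S).
Proof.
move=> cN; set u := undup (codom S).
have Nu : (N <= size u)%N.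
  have := leq_trans (size_undup_collisions (codom S)) (leq_add (leqnn _) cN).
  by rewrite size_codom card_ord [leqLHS]mul2n -addnn leq_add2r.
pose t := [ffun j : 'I_N => tnth (in_tuple u) (widen_ord Nu j)].
have t_inj : injective t.
  move=> i j; rewrite !ffunE.
  have /tuple_uniqP inj : uniq (in_tuple u) by apply: undup_uniq.
  by move/inj/(congr1 val) => /= /val_inj.
have tS j : t j \in codom S by rewrite ffunE -mem_undup mem_tnth.
move: t_inj tS; move: t => t t_inj tS.
have [k kS] : exists k : 'I_N -> 'I_(2 * N), forall j, S (k j) = t j.
  by exists (fun j => iinv (tS j)) => j; rewrite f_iinv.
exists t => // s; rewrite inE; apply/existsP; exists (finfun k); apply/andP; split.
  apply/injectiveP => i j; rewrite !ffunE => e; apply: t_inj.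
  by rewrite -!kS e.
by apply/forallP => j; rewrite !ffunE kS.
Qed.

Variables (N : nat) (f : {ffun 'I_N -> T} -> bool).

Let K : R := #|{perm T}|%:R.

Definition perm_average (t : {ffun 'I_N -> T}) : R :=
  (\sum_(s : {perm T}) (f (relabel s t))%:R) / K.

Let K_gt0 : 0 < K.
Proof. by rewrite ltr0n; apply/card_gt0P; exists 1%g. Qed.

Let bad (S : {ffun 'I_(2 * N) -> T}) := (N < collisions (codom S))%N.

(** On a good sample, the minimum is at most the value of [f] at the relabeled distinct subsample,
    whose average does not depend on the subsample. On a bad one, the bound 1 is the default value
    of the minimum. *)
Lemma sum_min_asub_le (t : {ffun 'I_N -> T}) S : injective t ->
  \sum_(s : {perm T}) min_asub R f (relabel s S)
    <= K * (perm_average t + (bad S)%:R).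
Proof.
move=> t_inj; rewrite mulrDr mulrC divfK ?gt_eqF //.
rewrite /bad; case: (ltnP N (collisions (codom S))) => [_|cN] /=.
  rewrite -[leLHS]add0r; apply: lerD; first by apply: sumr_ge0 => s _; apply: ler0n.
  rewrite mulr1 /K -sumr_const; apply: ler_sum => s _; exact: bigmin_le_id.
have [u u_inj uS] := asub_distinct cN.
rewrite mulr0 addr0 (sum_relabel (fun v => (f v)%:R) t_inj u_inj).
by apply: ler_sum => s _; apply: bigmin_le_cond.
Qed.

Lemma sum_max_asub_ge (t : {ffun 'I_N -> T}) S : injective t ->
  K * (perm_average t - (bad S)%:R)
    <= \sum_(s : {perm T}) max_asub R f (relabel s S).
Proof.
move=> t_inj; rewrite mulrBr mulrC divfK ?gt_eqF //.
rewrite /bad; case: (ltnP N (collisions (codom S))) => [_|cN] /=.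
  rewrite mulr1; apply: (@le_trans _ _ 0).
    rewrite subr_le0 /K -sumr_const; apply: ler_sum => s _.
    by rewrite lern1 leq_b1.
  by apply: sumr_ge0 => s _; apply: bigmax_ge_id.
have [u u_inj uS] := asub_distinct cN.
rewrite mulr0 subr0 (sum_relabel (fun v => (f v)%:R) t_inj u_inj).
by apply: ler_sum => s _; apply: le_bigmax_cond.
Qed.

(** The uniform law on all of [T] is invariant under relabeling, so the expectation equals its own
    average over permutations. *)
Lemma expect_min_asub_le (t : {ffun 'I_N -> T}) : injective t -> (0 < #|T|)%N ->
  expect_iid (unif R [set: T]) (min_asub R f)
    <= perm_average t + prob_iid (unif R [set: T]) bad.
Proof.
move=> t_inj T0; have dT : is_distr (unif R [set: T]).
  by apply: unif_distr; rewrite cardsT.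
rewrite -(ler_pM2l K_gt0) {1}/K mulr_natl -sumr_const.
have -> : \sum_(s : {perm T}) expect_iid (unif R [set: T]) (min_asub R f) =
    expect_iid (unif R [set: T]) (fun S => \sum_(s : {perm T}) min_asub R f (relabel s S)).
  rewrite -expect_iid_sum; apply: eq_bigr => s _.
  rewrite -expect_unif_relabel; congr (expect_iid (unif R _)).
  by apply/setP => x; rewrite inE -(permKV s x) (mem_imset _ _ (@perm_inj _ s)) inE.
rewrite prob_iidE -[perm_average t](expect_iid_cst dT (2 * N)).
by rewrite -expect_iidD -expect_iidZ; apply: le_expect_iid => // S; apply: sum_min_asub_le.
Qed.

(** A proper subset is moved by relabeling, so averaging over permutations only yields some good
    image of [A]. *)
Lemma exists_expect_max_asub_ge (A : {set T}) (t : {ffun 'I_N -> T}) :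
  injective t -> (0 < #|A|)%N ->
  exists s : {perm T}, perm_average t - prob_iid (unif R A) bad
    <= expect_iid (unif R (s @: A)) (max_asub R f).
Proof.
move=> t_inj A0; have dA := unif_distr A0.
set b := _ - _; case: (pickP (fun s : {perm T} =>
  b <= expect_iid (unif R (s @: A)) (max_asub R f))) => [s|no]; first by exists s.
suff : K * b < K * b by rewrite ltxx.
apply: (@le_lt_trans _ _ (\sum_(s : {perm T}) expect_iid (unif R (s @: A)) (max_asub R f))).
  under eq_bigr do rewrite expect_unif_relabel.
  rewrite expect_iid_sum /b prob_iidE -[perm_average t](expect_iid_cst dA (2 * N)).
  rewrite -[X in _ - X]mul1r -mulNr -expect_iidZ -expect_iidD -expect_iidZ.
  apply: le_expect_iid => // S; rewrite mulN1r; exact: sum_max_asub_ge.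
rewrite /K mulr_natl -sumr_const; apply: ltr_sum => [|s _].
  by apply/hasP; exists 1%g; rewrite // mem_index_enum.
by rewrite ltNge no.
Qed.

(** Markov: the mean is at most 2N^2/|A| <= N/100, while a bad sample has at least N + 1 collisions,
    a threshold that stays positive when N = 0. *)
Lemma prob_bad_le (A : {set T}) : (0 < #|A|)%N -> (200 * N <= #|A|)%N ->
  prob_iid (unif R A) bad <= 1 / 100.
Proof.
move=> A0 NA; have dA := unif_distr A0; have a0 : 0 < #|A|%:R :> R by rewrite ltr0n.
have N1 : 0 < N.+1%:R :> R by rewrite ltr0n.
have unif_le x : unif R A x <= #|A|%:R^-1.
  by rewrite /unif; case: ifP => // _; rewrite invr_ge0 ltW.
have := prob_many_collisions dA (2 * N) unif_le N1.
have -> : prob_iid (unif R A) bad = prob_iid (unif R A)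
    (fun S : {ffun 'I_(2 * N) -> T} => N.+1%:R <= (collisions (codom S))%:R :> R).
  by apply: eq_bigl => S; rewrite ler_nat.
move/le_trans; apply; rewrite ler_pdivrMr // ler_pdivrMr // natrM.
move: NA; rewrite -(ler_nat R) natrM => NA.
have : 0 <= (#|A|%:R - 200 * N%:R) * (N%:R + 1) :> R.
  by rewrite mulr_ge0 ?subr_ge0 ?natr1.
by rewrite -[N.+1%:R]natr1; have := ler0n R N; nra.
Qed.

End Permutation.

(** * The collision tester *)

Section Tester.
Variables (R : realFieldType) (T : finType).

Lemma osub_unif_le (A : {set T}) (D : T -> R) x :
  in_osub (unif R A) D -> D x <= 2 / #|A|%:R.
Proof.
case=> _ /(_ x); move/le_trans; apply; rewrite ler_pM2l // /unif.
by case: ifP; rewrite // invr_ge0 ler0n.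
Qed.

Lemma osub_unif_eq0 (A : {set T}) (D : T -> R) x :
  in_osub (unif R A) D -> x \notin A -> D x = 0.
Proof.
case=> -[D0 _] DA /negPf xA; apply/eqP; rewrite eq_le D0 andbT.
by rewrite (le_trans (DA x)) // /unif xA mulr0.
Qed.

(** For supports of size at least k the mean number of collisions is at most n^2/k; the factor 100
    makes Markov's inequality give 1/100. *)
Definition collision_test (n k : nat) (S : {ffun 'I_n -> T}) : bool :=
  (collisions (codom S))%:R <= 100 * n%:R ^+ 2 / k%:R :> R.

Lemma collision_test_large n k (A : {set T}) (D : T -> R) :
  (0 < n)%N -> (0 < k <= #|A|)%N -> in_osub (unif R A) D ->
  99 / 100 <= prob_iid D (collision_test k (n := n)).
Proof.
move=> n0 /andP[k0 kA] DA; have D1 : is_distr D by case: DA.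
set a : R := #|A|%:R; have kR : 0 < k%:R :> R by rewrite ltr0n.
have ka : k%:R <= a by rewrite ler_nat.
have n2 : 0 < n%:R ^+ 2 :> R by rewrite exprn_gt0 // ltr0n.
set t := 100 * n%:R ^+ 2 / k%:R : R; have t0 : 0 < t by rewrite divr_gt0 // mulr_gt0.
rewrite prob_iidC //.
have := prob_many_collisions D1 n (fun x => osub_unif_le x DA) t0.
have : prob_iid D (fun S : {ffun 'I_n -> T} => ~~ collision_test k S) <=
    prob_iid D (fun S : {ffun 'I_n -> T} => t <= (collisions (codom S))%:R).
  rewrite !prob_iidE; apply: le_expect_iid => // S.
  rewrite ler_nat /collision_test -/t -ltNge.
  by case: ltP => //= /ltW ->.
have : n%:R ^+ 2 / 2 * (2 / a) / t <= 1 / 100.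
  rewrite ler_pdivrMr // (_ : 1 / 100 * t = n%:R ^+ 2 / k%:R); last first.
    by rewrite /t; field; rewrite gt_eqF.
  rewrite (_ : n%:R ^+ 2 / 2 * (2 / a) = n%:R ^+ 2 / a); last first.
    by field; rewrite gt_eqF // (lt_le_trans kR).
  by rewrite ler_pM2l // lef_pV2 // posrE (lt_le_trans kR).
rewrite -/a; lra.
Qed.

(** The second moment is at least 800/k and n(n - 1)/2 >= n^2/4, so the mean is at least 200 n^2/k:
    twice the threshold, and at least 800 since n^2 >= 4k. *)
Lemma collision_test_small n k (A : {set T}) (D : T -> R) :
  6400 <= n%:R :> R -> 4 * k%:R <= n%:R ^+ 2 :> R -> (0 < #|A|)%N ->
  #|A|%:R <= 1 / 800 * k%:R :> R -> in_osub (unif R A) D ->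
  prob_iid D (collision_test k (n := n)) <= 1 / 100.
Proof.
move=> n_ge kn A0 Ak DA; have D1 : is_distr D by case: DA.
move: Ak; set a : R := #|A|%:R => Ak; have a0 : 0 < a by rewrite ltr0n.
have k0 : 0 < k%:R :> R by lra.
have m2 : a^-1 <= moment D 2.
  by apply: moment2_ge => // x; apply: osub_unif_eq0.
have m3 : moment D 3 <= 2 * moment D 2 ^+ 2.
  apply: le_trans (momentS_le D1 2 (fun x => osub_unif_le x DA)) _.
  rewrite -/a expr2 mulrA ler_wpM2r ?moment_ge0 //; lra.
have m2k : 800 / k%:R <= moment D 2.
  apply: le_trans m2; rewrite ler_pdivrMr // mulrC ler_pdivlMr //; lra.
have mu_ge : 200 * (n%:R ^+ 2 / k%:R) <= n%:R * (n%:R - 1) / 2 * moment D 2.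
  apply: (@le_trans _ _ (n%:R * (n%:R - 1) / 2 * (800 / k%:R))).
    rewrite (_ : 200 * _ = n%:R ^+ 2 / 4 * (800 / k%:R)); last first.
      by field; rewrite gt_eqF.
    apply: ler_wpM2r; first by rewrite divr_ge0 // ltW.
    by nra.
  by apply: ler_wpM2l => //; nra.
have nk : 4 <= n%:R ^+ 2 / k%:R :> R by rewrite ler_pdivlMr.
by apply: prob_few_collisions => //; [lra | rewrite -mulrA; lra].
Qed.
End Tester.

Theorem mainTheorem15 (R : realType) :
  exists (c C c' : R) (m0 : nat),
    [/\ 0 < c, c < 1, 0 < C, 0 < c' &
    forall m : nat, (m0 <= m)%N ->
      (* part (1): oblivious contamination, n_small = ceil(C sqrt m) samples *)
      (let n_small := `|Num.ceil (C * Num.sqrt (m%:R))|%N in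
       forall k : nat, (1 <= k <= m)%N ->
       exists f : {ffun 'I_n_small -> 'I_m} -> bool,
         forall X' : {set 'I_m}, (0 < #|X'|)%N ->
           ((k <= #|X'|)%N ->
              forall D' : 'I_m -> R, in_osub (unif R X') D' ->
                prob_iid D' f >= 99%:R / 100%:R)
           /\
           (#|X'|%:R <= c * k%:R ->
              forall D' : 'I_m -> R, in_osub (unif R X') D' ->
                prob_iid D' f <= 1 / 100%:R))
      /\
      (* part (2): adaptive contamination, N = floor(c' m) samples, k = m *)
      (let N := `|Num.floor (c' * m%:R)|%N in
       forall f : {ffun 'I_N -> 'I_m} -> bool,
         (exists X' : {set 'I_m}, #|X'| = m /\
            expect_iid (unif R X') (min_asub R f) <= 51%:R / 100%:R)
         \/
         (exists X' : {set 'I_m}, (0 < #|X'|)%N /\ #|X'|%:R <= c * m%:R /\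
            expect_iid (unif R X') (max_asub R f) >= 49%:R / 100%:R))].

Proof.
(* [c] and [C] come from [collision_test_small]; [c'] = [c]/400 ensures 200 N <= floor(m/800), as
   [prob_bad_le] requires; m >= 1600 keeps floor(m/800) positive. *)
exists (1 / 800), 6400, (1 / 800 / 400), 1600%N; split; [lra.. | move=> m m_ge].
have mR : 1600 <= m%:R :> R by rewrite ler_nat.
split.
  move=> n k /andP[k1 km].
  have n_ge : 6400 * Num.sqrt m%:R <= n%:R :> R.
    by rewrite natr_absz ger0_norm ?ceil_ge // ceil_ge0 (lt_le_trans (ltrN10 R)) ?mulr_ge0 ?sqrtr_ge0.
  have sm1 : 1 <= Num.sqrt m%:R :> R.
    by rewrite -[leLHS]sqrtr1 ler_wsqrtr //; lra.
  have n_ge' : 6400 <= n%:R :> R by lra.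
  exists (collision_test R k (n := n)) => A A0; split=> [kA|Ak] D DA.
    apply: (collision_test_large _ _ DA); last by rewrite k1.
    by rewrite -(ltr_nat R); lra.
  apply: (collision_test_small n_ge' _ A0 Ak DA).
  have km' : k%:R <= m%:R :> R by rewrite ler_nat.
  have := sqr_sqrtr (ler0n R m); nra.
move=> N f; pose s := (m %/ 800)%N.
have NR : N%:R <= 1 / 800 / 400 * m%:R :> R.
  rewrite natr_absz ger0_norm ?floor_le // floor_ge0; lra.
have mN : (400 * (800 * N) <= m)%N by rewrite -(ler_nat R) !natrM; lra.
have sN : (200 * N <= s)%N by rewrite /s; lia.
have s0 : (0 < s)%N by rewrite /s; lia.
have sm : (s <= m)%N by rewrite /s; lia.
have Nm : (N <= m)%N by lia.
(* Any injective tuple would do, since [perm_average] is the same on all of them. *)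
pose t : {ffun 'I_N -> 'I_m} := [ffun i => widen_ord Nm i].
have t_inj : injective t.
  by move=> i j; rewrite !ffunE => /(congr1 val) /= /val_inj.
pose A : {set 'I_m} := [set widen_ord sm i | i : 'I_s].
have As : #|A| = s.
  by rewrite card_imset ?card_ord // => i j /(congr1 val) /= /val_inj.
have [p_le|p_ge] := lerP (perm_average R f t) (1 / 2).
  left; exists [set: 'I_m]; rewrite cardsT card_ord; split=> //.
  have m0 : (0 < #|'I_m|)%N by rewrite card_ord; lia.
  have := expect_min_asub_le R f t_inj m0.
  have : prob_iid (unif R [set: 'I_m]) (fun S : {ffun 'I_(2 * N) -> 'I_m} =>
      (N < collisions (codom S))%N) <= 1 / 100.
    by apply: prob_bad_le; rewrite cardsT card_ord //; lia.
  lra.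
right; have A0 : (0 < #|A|)%N by rewrite As.
have [a a_ge] := exists_expect_max_asub_ge R f t_inj A0.
exists (a @: A); rewrite (card_imset _ (@perm_inj _ a)) As; split=> //; split.
  have : (800 * s <= m)%N by rewrite /s; lia.
  by rewrite -(ler_nat R) natrM; lra.
have : prob_iid (unif R A) (fun S : {ffun 'I_(2 * N) -> 'I_m} =>
    (N < collisions (codom S))%N) <= 1 / 100.
  by apply: prob_bad_le => //; rewrite As.
lra.
Qed.
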